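(* Let $G:\mathbb{R}^n\to\mathbb{R}^n$ be Lipschitz continuous with constant $c<1$ (with $c\ge 0$), i.e. $\|G(\mathbf{u})-G(\mathbf{v})\|\le c\|\mathbf{u}-\mathbf{v}\|$ for all $\mathbf{u},\mathbf{v}\in\mathbb{R}^n$, and differentiable at its fixed point $\mathbf{u}^*$. Let $\lambda\in(0,1]$, $\mathbf{u}_0\in\mathbb{R}^n$, and let $\{\mathbf{u}_k\}$ be the (infinite) sequence generated by the algorithm GlobAA($1$) (memory size $m=1$). Suppose that the parameters $\{\gamma_k\}_{k\ge 0}$ satisfy: (i) $\gamma_k\in(0,1)$ for all $k\ge 0$; (ii) $\{\gamma_k\}$ is non-decreasing and $\gamma_k\to 1$ as $k\to\infty$; (iii) $\sum_{k=0}^\infty(1-\gamma_k)=\infty$. Suppose also that the coefficients $\{\alpha_j^k\}_{j=0}^{m_k}$ satisfy, for all $k\ge 1$: (a) $\big\|\sum_{j=0}^{m_k}\alpha_j^kF_{k-m_k+j}\big\|\le\|F_k\|$; (b) $\sum_{j=0}^{m_k}\alpha_j^k=1$; (c) $\sum_{j=0}^{m_k}|\alpha_j^k|\le M_\alpha$ for some constant $M_\alpha\ge 1$ independent of $k$. Then $$\limsup_{k\to\infty}\frac{\|F(\mathbf{u}_{k+1})\|}{\|F(\mathbf{u}_k)\|}\le c.$$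
   Context: $\|\cdot\|$ is the Euclidean norm on $\mathbb{R}^n$. For $G:\mathbb{R}^n\to\mathbb{R}^n$ the residual mapping is $F(\mathbf{u}):=G(\mathbf{u})-\mathbf{u}$. Algorithm GlobAA($m$). Inputs: $\mathbf{u}_0\in\mathbb{R}^n$, a positive integer $m$, $\lambda\in(0,1]$, and a rule for choosing $\gamma_k\in(0,1)$. Initialize $k=0$, $\kappa=0$. While $\|F(\mathbf{u}_k)\|>0$, do the following. (1) Set $m_k=\min\{m,k-\kappa\}$, $G_k=G(\mathbf{u}_k)$, $F_k=G_k-\mathbf{u}_k$, and choose $\gamma_k$. (2) Let $(\alpha_0^k,\dots,\alpha_{m_k}^k)$ be a solution of $\min\big\|\sum_{j=0}^{m_k}\alpha_jF_{k-m_k+j}\big\|$ subject to $\sum_{j=0}^{m_k}\alpha_j=1$, and set $\mathbf{u}_{\rm AA}^{k+1}=\sum_{j=0}^{m_k}\alpha_j^kG_{k-m_k+j}$. (3) If $\|F(\mathbf{u}_{\rm AA}^{k+1})\|\le\gamma_k\max_{0\le j\le m_k}\|F_{k-m_k+j}\|$ (acceptance condition), set $\mathbf{u}_{k+1}=\mathbf{u}_{\rm AA}^{k+1}$ (Anderson step, $\kappa$ unchanged); otherwise set $\mathbf{u}_{k+1}=(1-\lambda)\mathbf{u}_k+\lambda G_k$ and reset $\kappa=k+1$ (Krasnosel'skii–Mann step). (4) Replace $k$ by $k+1$. For $m=1$ and $m_k=1$, writing $(\alpha_0^k,\alpha_1^k)=(\alpha^k,1-\alpha^k)$, the solution of the subproblem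 is $\alpha^k=\dfrac{F_k^\top(F_k-F_{k-1})}{\|F_k-F_{k-1}\|^2}$ if $F_k\ne F_{k-1}$, and the convention $\alpha^k=0$ is used if $F_k=F_{k-1}$; thus $\mathbf{u}_{\rm AA}^{k+1}=(1-\alpha^k)G_k+\alpha^kG_{k-1}$. For $m_k=0$, $\mathbf{u}_{\rm AA}^{k+1}=G_k$. Standing assumption: the algorithm never stops, i.e. $F(\mathbf{u}_k)\ne 0$ for all $k\ge 0$, so that an infinite sequence is generated. *)

(* Defs.v *)
From HB Require Import structures.
From mathcomp Require Import all_boot all_order all_algebra.
From mathcomp Require Import all_classical all_reals all_analysis.

Set Implicit Arguments.
Unset Strict Implicit.
Unset Printing Implicit Defensive.

Import Order.TTheory GRing.Theory Num.Theory.
Import numFieldNormedType.Exports.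

Local Open Scope classical_set_scope.
Local Open Scope ring_scope.

(* The norm `|u| that the library puts on column vectors is the sup norm, so
   the Euclidean norm has to be introduced separately. *)
Definition enorm (R : realType) (n : nat) (u : 'cV[R]_n) : R :=
  Num.sqrt (\sum_(i < n) u i 0 ^+ 2).

Definition residual (R : realType) (n : nat) (G : 'cV[R]_n -> 'cV[R]_n)
    (u : 'cV[R]_n) : 'cV[R]_n :=
  G u - u.

(* In the next four definitions, p stands for m_k.  The coefficients are given
   by a : nat -> R, of which only a 0, ..., a p are used.  Whenever p <= k (as
   is the case for m_k), the subtraction in k - p + j is exact. *)

Definition aa_residual (R : realType) (n : nat) (G : 'cV[R]_n -> 'cV[R]_n)
    (u : nat -> 'cV[R]_n) (k p : nat) (a : nat -> R) : 'cV[R]_n :=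
  \sum_(j < p.+1) a j *: residual G (u (k - p + j)%N).

Definition aa_solution (R : realType) (n : nat) (G : 'cV[R]_n -> 'cV[R]_n)
    (u : nat -> 'cV[R]_n) (k p : nat) (a : nat -> R) : Prop :=
  \sum_(j < p.+1) a j = 1 /\
  forall b : nat -> R, \sum_(j < p.+1) b j = 1 ->
    enorm (aa_residual G u k p a) <= enorm (aa_residual G u k p b).

Definition aa_candidate (R : realType) (n : nat) (G : 'cV[R]_n -> 'cV[R]_n)
    (u : nat -> 'cV[R]_n) (k p : nat) (a : nat -> R) : 'cV[R]_n :=
  \sum_(j < p.+1) a j *: G (u (k - p + j)%N).

(* The default value 0 of the maximum is harmless: the maximum ranges over a
   nonempty family of nonnegative numbers. *)
Definition aa_accepted (R : realType) (n : nat) (G : 'cV[R]_n -> 'cV[R]_n)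
    (gamma : R) (u : nat -> 'cV[R]_n) (k p : nat) (a : nat -> R) : bool :=
  enorm (residual G (aa_candidate G u k p a)) <=
  gamma * \big[Num.max/0]_(j < p.+1) enorm (residual G (u (k - p + j)%N)).

Definition memory (m : nat) (kappa : nat -> nat) (k : nat) : nat :=
  minn m (k - kappa k).

(* An infinite run of GlobAA(m): kappa k is the value of the variable kappa at
   the start of iteration k, and alpha k j is the coefficient alpha_j^k.  The
   step is described at every k; that the loop never stops is a separate
   hypothesis. *)
Record globAA (R : realType) (n : nat) (G : 'cV[R]_n -> 'cV[R]_n) (m : nat)
    (lambda : R) (gamma : nat -> R) (u0 : 'cV[R]_n)
    (u : nat -> 'cV[R]_n) (kappa : nat -> nat) (alpha : nat -> nat -> R)
    : Prop := GlobAA {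
  globAA_u0 : u 0%N = u0;
  globAA_kappa0 : kappa 0%N = 0%N;
  globAA_alpha : forall k : nat,
    aa_solution G u k (memory m kappa k) (alpha k);
  globAA_u : forall k : nat,
    u k.+1 =
    if aa_accepted G (gamma k) u k (memory m kappa k) (alpha k)
    then aa_candidate G u k (memory m kappa k) (alpha k)
    else (1 - lambda) *: u k + lambda *: G (u k);
  globAA_kappa : forall k : nat,
    kappa k.+1 =
    if aa_accepted G (gamma k) u k (memory m kappa k) (alpha k)
    then kappa k
    else k.+1
}.

(* For m = 1 and m_k = 1, the subproblem has the unique solution
   (alpha^k, 1 - alpha^k), with
   alpha^k = F_k^T (F_k - F_(k-1)) / ||F_k - F_(k-1)||^2, unless
   F_k = F_(k-1); in that case alpha^k is set to 0. *)
Definition globAA1_convention (R : realType) (n : nat)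
    (G : 'cV[R]_n -> 'cV[R]_n) (u : nat -> 'cV[R]_n) (kappa : nat -> nat)
    (alpha : nat -> nat -> R) : Prop :=
  forall k : nat, memory 1 kappa k = 1%N ->
    residual G (u k) = residual G (u k.-1) -> alpha k 0%N = 0.

(* Main.v *)
Require Import Defs.
From HB Require Import structures.
From mathcomp Require Import all_boot all_order all_algebra.
From mathcomp Require Import all_classical all_reals all_analysis.
From mathcomp Require Import ring lra zify.
Import Order.TTheory GRing.Theory Num.Theory.
Import numFieldNormedType.Exports.
Local Open Scope classical_set_scope.
Local Open Scope ring_scope.

(** Write [F_k] for the residual at [u_k] and [|.|] for the Euclidean norm.

    Global part.  Whatever the step, [|F_(k+1)|] is at most
    [1 - lambda (1 - c) (1 - gamma_k)] times the larger of [|F_k|] and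
    [|F_(k-1)|].  As the series of the [1 - gamma_k] diverges, the residuals
    tend to 0 ([globAA_residual_cvg0], from [cvg0_max_contraction]), and since
    [G] is a contraction the iterates approach [ustar].

    Local part.  Let [ubar] be the combination of [u_k] and [u_(k-1)] with the
    Anderson coefficients, and [Fbar] that of the residuals, so that the
    candidate is [x = ubar + Fbar].  Its residual splits as
    [(G x - G ubar) + (G ubar - \sum_j alpha_j G u_j)].  The first part is at
    most [c |Fbar| <= c |F_k|].  In the second, the coefficients sum to 1, so
    the affine approximation of [G] at [ustar] cancels and what remains is
    [o(\sum_j `|alpha_j| |F_j|)] ([enorm_residual_mixture]).  Now
    [|Fbar| <= |F_k|] and the bound on the coefficients give
    [`|alpha_0| |F_(k-1)| = O(|F_k|)] even when [F_k] is much smaller than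
    [F_(k-1)] ([weighted_residuals_le]).  So the residual of the candidate is at
    most [(c + eps) |F_k|] for all large [k].

    Conclusion.  Because [gamma_k] tends to 1 and [c + eps < 1], such a
    candidate passes the acceptance test, hence [u_(k+1)] is the candidate and
    the ratio of consecutive residuals is eventually at most [c + eps]. *)

(** * The Euclidean norm *)

Section EuclideanNorm.
Context {R : realType} {n : nat}.
Implicit Types v w : 'cV[R]_n.

Lemma enorm_ge0 v : 0 <= enorm v.
Proof. exact: sqrtr_ge0. Qed.

Lemma sqr_enorm v : enorm v ^+ 2 = \sum_(i < n) v i 0 ^+ 2.
Proof. by rewrite sqr_sqrtr// sumr_ge0// => i _; exact: sqr_ge0. Qed.

Lemma enormZ (a : R) v : enorm (a *: v) = `|a| * enorm v.
Proof.
rewrite /enorm -sqrtr_sqr -sqrtrM ?sqr_ge0//; congr Num.sqrt.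
by rewrite mulr_sumr; apply: eq_bigr => i _; rewrite mxE exprMn.
Qed.

Lemma enormN v : enorm (- v) = enorm v.
Proof. by rewrite -scaleN1r enormZ normrN1 mul1r. Qed.

Lemma enorm0 : enorm (0 : 'cV[R]_n) = 0.
Proof. by rewrite /enorm big1 ?sqrtr0// => i _; rewrite mxE expr0n. Qed.

Lemma enorm_eq0 v : (enorm v == 0) = (v == 0).
Proof.
apply/idP/eqP => [|->]; last by rewrite enorm0.
rewrite -sqrf_eq0 sqr_enorm psumr_eq0; last by move=> i _; exact: sqr_ge0.
move=> /allP v0; apply/colP => i; rewrite mxE.
by have := v0 i (mem_index_enum _); rewrite /= sqrf_eq0 => /eqP.
Qed.

(** Summing the squares of [|w| v_i - |v| w_i] gives
    [2 |v| |w| (|v| |w| - <v, w>)], so the last factor is nonnegative as soon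
    as neither vector vanishes. *)
Lemma cauchy_schwarz v w : \sum_(i < n) v i 0 * w i 0 <= enorm v * enorm w.
Proof.
have [vw0|vw_neq0] := eqVneq (enorm v * enorm w) 0.
  rewrite vw0 big1// => i _; move/eqP: vw0; rewrite mulf_eq0 !enorm_eq0.
  by case/orP => /eqP ->; rewrite mxE ?mul0r ?mulr0.
have vw_gt0 : 0 < enorm v * enorm w.
  by rewrite lt_neqAle eq_sym vw_neq0 mulr_ge0 ?enorm_ge0.
have sq : 0 <= \sum_(i < n) (enorm w * v i 0 - enorm v * w i 0) ^+ 2.
  by rewrite sumr_ge0// => i _; exact: sqr_ge0.
have eqsq : \sum_(i < n) (enorm w * v i 0 - enorm v * w i 0) ^+ 2 =
    2 * (enorm v * enorm w) * (enorm v * enorm w - \sum_(i < n) v i 0 * w i 0).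
  transitivity (enorm w ^+ 2 * \sum_(i < n) v i 0 ^+ 2
      + enorm v ^+ 2 * (\sum_(i < n) w i 0 ^+ 2)
      - 2 * (enorm v * enorm w) * \sum_(i < n) v i 0 * w i 0).
    rewrite !mulr_sumr -sumrN -!big_split/=.
    by apply: eq_bigr => i _; ring.
  by rewrite -!sqr_enorm; ring.
rewrite -subr_ge0 -(@pmulr_rge0 _ (2 * (enorm v * enorm w))) -?eqsq//.
exact: mulr_gt0.
Qed.

Lemma enormD v w : enorm (v + w) <= enorm v + enorm w.
Proof.
rewrite -(@ler_pXn2r _ 2)// ?nnegrE ?addr_ge0 ?enorm_ge0//.
have -> : enorm (v + w) ^+ 2 =
    enorm v ^+ 2 + enorm w ^+ 2 + 2 * \sum_(i < n) v i 0 * w i 0.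
  rewrite !sqr_enorm mulr_sumr -!big_split/=.
  by apply: eq_bigr => i _; rewrite mxE; ring.
have := cauchy_schwarz v w.
by set s := \sum_(i < n) _ => vw; nra.
Qed.

Lemma enormB v w : enorm (v - w) <= enorm v + enorm w.
Proof. by rewrite (le_trans (enormD _ _))// enormN. Qed.

Lemma enorm_sum (I : finType) (a : I -> R) (v : I -> 'cV[R]_n) :
  enorm (\sum_i a i *: v i) <= \sum_i `|a i| * enorm (v i).
Proof.
elim/big_ind2 : _ => [|x1 x2 y1 y2 h1 h2|i _].
- by rewrite enorm0.
- by rewrite (le_trans (enormD _ _))// lerD.
- by rewrite enormZ.
Qed.

Lemma norm_le_enorm v : `|v| <= enorm v.
Proof.
rewrite [`|v|]mx_normrE; apply: bigmax_le; first exact: enorm_ge0.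
move=> [i j] _ /=; rewrite (ord1 j) -sqrtr_sqr ler_sqrt; last first.
  by rewrite sumr_ge0// => k _; exact: sqr_ge0.
by rewrite (bigD1 i)//= lerDl sumr_ge0// => k _; exact: sqr_ge0.
Qed.

Lemma enorm_le_norm v : enorm v <= Num.sqrt n%:R * `|v|.
Proof.
rewrite -[`|v|]ger0_norm// -sqrtr_sqr -sqrtrM// ler_sqrt; last first.
  by rewrite mulr_ge0// sqr_ge0.
rewrite -[n in n%:R]card_ord -sum1_card natr_sum mulr_suml.
apply: ler_sum => i _; rewrite mul1r -real_normK ?num_real// ler_sqr ?nnegrE//.
rewrite [leRHS]mx_normrE; exact: (le_bigmax _ _ (i, ord0)).
Qed.

End EuclideanNorm.

(** Differentiability is phrased with the sup norm; the two norms are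
    equivalent, so the first-order expansion holds with an arbitrarily small
    relative error for the Euclidean norm as well. *)
Lemma differentiable_enorm (R : realType) (n : nat) (G : 'cV[R]_n -> 'cV[R]_n)
    (x : 'cV[R]_n) (eps : R) : differentiable G x -> 0 < eps ->
  exists2 delta : R, 0 < delta & forall v, enorm (v - x) <= delta ->
    enorm (G v - G x - 'd G x (v - x)) <= eps * enorm (v - x).
Proof.
move=> /diff_locally /eqaddoP dG eps_gt0.
set s : R := Num.sqrt n%:R + 1.
have s_gt0 : 0 < s by rewrite ltr_wpDl ?sqrtr_ge0.
have /dG /nbhs_norm0P[d /= d_gt0 dP] : 0 < eps / s by rewrite divr_gt0.
exists (d / 2) => [|v vd]; first by rewrite divr_gt0.
have vlt : `|v - x| < d.
  rewrite (le_lt_trans (norm_le_enorm _))// (le_lt_trans vd)//.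
  by rewrite ltr_pdivrMr// ltr_pMr// ltr1n.
have small : `|G v - G x - 'd G x (v - x)| <= eps / s * `|v - x|.
  have := dP _ vlt.
  rewrite /= -[X in `|X|]/(G (v - x + x) - (G x + 'd G x (v - x))).
  by rewrite subrK opprD addrA.
apply: le_trans (enorm_le_norm _) _.
apply: le_trans (_ : s * (eps / s * `|v - x|) <= _).
  by rewrite ler_pM ?sqrtr_ge0// lerDl.
by rewrite mulrA mulrCA divff ?gt_eqF// mulr1 ler_wpM2l ?norm_le_enorm// ltW.
Qed.

(** * Real sequences *)

Lemma nneseries_pinfty_partial (R : realType) (d : nat -> R) (A : R) :
  (forall k, 0 <= d k) -> (\sum_(0 <= k <oo) (d k)%:E)%E = +oo%E ->
  exists N, A < \sum_(0 <= k < N) d k.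
Proof.
move=> d_ge0 dvg; apply/not_existsP => H.
suff : ((+oo : \bar R) <= A%:E)%E by rewrite leye_eq.
rewrite -dvg; apply: lime_le.
  by apply: is_cvg_nneseries => k _ _; rewrite lee_fin.
by apply: nearW => N; rewrite sumEFin lee_fin leNgt; apply/negP/H.
Qed.

(** A recursion that looks two terms back contracts the maximum [M j] of two
    consecutive terms only every second step:
    [M j.+2 <= (1 - eta j.+2) * M j], where the monotonicity of [eta] makes the
    same factor serve for both terms of [M j.+2].  If [M] stayed above some
    [e > 0], summing [eta j.+2 * e <= M j - M j.+2] would telescope and bound
    the divergent series of the [eta j]. *)
Lemma cvg0_max_contraction (R : realType) (r eta : nat -> R) :
  (forall k, 0 <= r k) -> (forall k, 0 <= eta k <= 1) -> nonincreasing_seq eta ->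
  (\sum_(0 <= k <oo) (eta k)%:E)%E = +oo%E ->
  (forall k, r k.+1 <= (1 - eta k) * Num.max (r k.-1) (r k)) ->
  r @ \oo --> (0 : R).
Proof.
move=> r_ge0 eta01 eta_dec dvg step.
have eta_ge0 k : 0 <= eta k by have /andP[] := eta01 k.
have eta_le1 k : 0 <= 1 - eta k by rewrite subr_ge0; have /andP[] := eta01 k.
pose M j := Num.max (r j) (r j.+1).
have M_ge0 j : 0 <= M j by rewrite le_max r_ge0.
have rM j : r j.+2 <= (1 - eta j.+1) * M j by exact: step.
have rMle j : r j.+2 <= M j.
  apply: le_trans (rM j) _.
  by rewrite ler_piMl// lerBlDr lerDl.
have Mdec : nonincreasing_seq M.
  apply/nonincreasing_seqP => j.
  by rewrite {1}/M ge_max rMle andbT /M le_max lexx orbT.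
have M2 j : eta j.+2 * M j <= M j - M j.+2.
  suff : M j.+2 <= (1 - eta j.+2) * M j by lra.
  rewrite {1}/M ge_max; apply/andP; split.
    apply: le_trans (rM j) _.
    by rewrite ler_wpM2r// lerB// eta_dec.
  by apply: le_trans (rM j.+1) _; rewrite ler_wpM2l// Mdec.
have Mtel N : \sum_(0 <= j < N) (M j - M j.+2) <= M 0%N + M 1%N.
  have -> : \sum_(0 <= j < N) (M j - M j.+2) = M 0%N + M 1%N - (M N + M N.+1).
    elim: N => [|N IH]; first by rewrite big_geq// subrr.
    by rewrite big_nat_recr//= IH; ring.
  by rewrite gerBl addr_ge0.
apply/cvgrPdist_le => e e_gt0.
have [j Mj] : exists j, M j <= e.
  apply/not_existsP => H.
  have Mgt j : e < M j by rewrite ltNge; apply/negP/H.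
  have [N] := nneseries_pinfty_partial _ _ (2 + (M 0%N + M 1%N) / e) eta_ge0 dvg.
  apply/negP; rewrite -leNgt.
  (* M2 controls eta from index 2 on; the first two terms are at most 1 each *)
  apply: le_trans (_ : \sum_(0 <= k < N.+2) eta k <= _).
    rewrite !big_nat_recr//= -addrA lerDl addr_ge0//.
  rewrite big_nat_recl// big_nat_recl//= addrA lerD//.
    by have /andP[_] := eta01 0%N; have /andP[_] := eta01 1%N; lra.
  rewrite ler_pdivlMr// (le_trans _ (Mtel N))// mulr_suml.
  apply: ler_sum => k _; apply: le_trans (M2 k).
  by rewrite ler_wpM2l// ltW.
near=> k; rewrite sub0r normrN ger0_norm//.
apply: le_trans Mj; apply: le_trans (_ : M k <= _).
  by rewrite /M le_max lexx.
by apply: Mdec; near: k; exact: nbhs_infty_ge.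
Unshelve. all: by end_near. Qed.

Lemma limn_esup_le_near (R : realType) (f : nat -> R) (c : R) :
  (forall eps, 0 < eps -> \forall k \near \oo, f k <= c + eps) ->
  (limn_esup (fun k => (f k)%:E) <= c%:E)%E.
Proof.
move=> fc; apply/lee_addgt0Pr => eps /fc near_fc.
rewrite /limn_esup limf_esupE; apply: ereal_inf_le.
exists (ereal_sup ((fun k => (f k)%:E) @` [set k | f k <= c + eps])).
  by exists [set k | f k <= c + eps].
by apply: ge_ereal_sup => _ [k /= fk <-]; rewrite -EFinD lee_fin.
Qed.

(** * Residuals of a contraction *)

Section Contraction.
Context {R : realType} {n : nat} {G : 'cV[R]_n -> 'cV[R]_n} {c : R}.
Context (G_lip : forall v w, enorm (G v - G w) <= c * enorm (v - w)).

(** Near the fixed point the size of the residual measures the distance to it;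
    this is what turns a residual bound into the smallness that the expansion
    of [G] at the fixed point asks for. *)
Lemma dist_fixed_point_le (ustar v : 'cV[R]_n) : G ustar = ustar ->
  (1 - c) * enorm (v - ustar) <= enorm (residual G v).
Proof.
move=> fixed; have := G_lip v ustar; rewrite fixed => lip.
have -> : residual G v = - (v - ustar - (G v - ustar)).
  by rewrite /residual opprB opprB addrA subrK.
have := enormD (v - ustar - (G v - ustar)) (G v - ustar).
by rewrite subrK enormN; lra.
Qed.

(** With [w := v + lambda *: F v] the new residual is
    [(G w - G v) + (1 - lambda) *: F v], and [w - v] has norm
    [lambda * |F v|]. *)
Lemma enorm_residual_km (lambda : R) (v : 'cV[R]_n) :
  0 <= lambda <= 1 ->
  enorm (residual G ((1 - lambda) *: v + lambda *: G v)) <=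
  (1 - lambda * (1 - c)) * enorm (residual G v).
Proof.
move=> /andP[l0 l1]; set w := _ + _ *: G v.
have wE : w = v + lambda *: residual G v.
  by rewrite /w /residual scalerBr scalerBl scale1r addrA addrAC.
have -> : residual G w = (G w - G v) + (1 - lambda) *: residual G v.
  rewrite {1}/residual {2}wE scalerBl scale1r opprD addrA {2}/residual.
  by rewrite addrA addrA subrK.
apply: le_trans (enormD _ _) _; rewrite enormZ ger0_norm ?subr_ge0//.
have := G_lip w v; rewrite [w - v]addrC {2}wE addKr enormZ ger0_norm//.
by move: (enorm _) (enorm _) => x y; lra.
Qed.

(** Compare [x := \sum_i a i *: G (v i)] with [vbar := \sum_i a i *: v i].
    Since [x - vbar] is the weighted residual [\sum_i a i *: F (v i)], the
    contraction property gives [|G x - G vbar| <= c * |x - vbar|].  What is left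
    of [F x = G x - x] is [G vbar - \sum_i a i *: G (v i)]: the affine part of
    [G] at [ustar] cancels because the weights sum to 1, so only remainders
    survive.  They are controlled by the distances to [ustar], hence by the
    residuals weighted with [`|a i|]. *)
Lemma enorm_residual_mixture (L : {linear 'cV[R]_n -> 'cV[R]_n})
    (ustar : 'cV[R]_n) (eps delta : R) (I : finType) (a : I -> R)
    (v : I -> 'cV[R]_n) :
  0 <= c -> c < 1 -> 0 <= eps -> G ustar = ustar ->
  (forall w, enorm (w - ustar) <= delta ->
    enorm (G w - ustar - L (w - ustar)) <= eps * enorm (w - ustar)) ->
  \sum_i a i = 1 ->
  (forall i, enorm (residual G (v i)) <= (1 - c) * delta) ->
  \sum_i `|a i| * enorm (residual G (v i)) <= (1 - c) * delta ->
  enorm (residual G (\sum_i a i *: G (v i))) <=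
    c * enorm (\sum_i a i *: residual G (v i)) +
    2 * eps / (1 - c) * \sum_i `|a i| * enorm (residual G (v i)).
Proof.
move=> c_ge0 c_lt1 eps_ge0 fixed linG a1 v_small av_small.
have c1 : 0 < 1 - c by rewrite subr_gt0.
have dist w : enorm (w - ustar) <= enorm (residual G w) / (1 - c).
  by rewrite ler_pdivlMr// mulrC dist_fixed_point_le.
set S := \sum_i `|a i| * enorm (residual G (v i)) in av_small *.
pose rem w := G w - ustar - L (w - ustar).
pose vbar := \sum_i a i *: v i.
have sum_shift (f : I -> 'cV[R]_n) (w : 'cV[R]_n) :
    \sum_i a i *: (f i - w) = \sum_i a i *: f i - w.
  under eq_bigr do rewrite scalerBr.
  by rewrite sumrB -scaler_suml a1 scale1r.
have S_dist : \sum_i `|a i| * enorm (v i - ustar) <= S / (1 - c).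
  rewrite mulr_suml; apply: ler_sum => i _.
  by rewrite -mulrA ler_wpM2l.
have vbar_dist : enorm (vbar - ustar) <= S / (1 - c).
  by rewrite /vbar -sum_shift; exact: le_trans (enorm_sum _ _ _) S_dist.
have rem_vbar : enorm (rem vbar) <= eps * (S / (1 - c)).
  apply: le_trans (linG _ _) _; last by rewrite ler_wpM2l.
  by apply: le_trans vbar_dist _; rewrite ler_pdivrMr// mulrC.
have rem_v : enorm (\sum_i a i *: rem (v i)) <= eps * (S / (1 - c)).
  apply: le_trans (enorm_sum _ _ _) _.
  apply: le_trans (ler_wpM2l eps_ge0 S_dist).
  rewrite mulr_sumr; apply: ler_sum => i _; rewrite mulrCA ler_wpM2l// linG//.
  by apply: le_trans (dist _) _; rewrite ler_pdivrMr// mulrC.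
have -> : residual G (\sum_i a i *: G (v i)) =
    (G (\sum_i a i *: G (v i)) - G vbar) + (rem vbar - \sum_i a i *: rem (v i)).
  have -> : \sum_i a i *: rem (v i) =
      \sum_i a i *: G (v i) - ustar - L (vbar - ustar).
    rewrite /rem -[in RHS]sum_shift -[X in L X]sum_shift linear_sum -sumrB.
    by apply: eq_bigr => i _; rewrite linearZ scalerBr.
  rewrite /rem /residual; move: (L _) (G vbar) => l g.
  by apply/colP => i; rewrite !mxE; ring.
apply: le_trans (enormD _ _) _; apply: lerD.
  apply: le_trans (G_lip _ _) _; rewrite ler_wpM2l//.
  have -> // : \sum_i a i *: G (v i) - vbar = \sum_i a i *: residual G (v i).
  by rewrite /vbar -sumrB; apply: eq_bigr => i _; rewrite scalerBr.
apply: le_trans (enormB _ _) _; apply: le_trans (lerD rem_vbar rem_v) _.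
by rewrite -!mulrA [_^-1 * S]mulrC; lra.
Qed.

End Contraction.

(** * Runs of the algorithm with memory one *)

Section Run.
Context {R : realType} {n : nat} {G : 'cV[R]_n -> 'cV[R]_n}.
Implicit Types (u : nat -> 'cV[R]_n) (a : nat -> R) (k p : nat).

Lemma memory1_bounds (kappa : nat -> nat) k :
  (memory 1 kappa k <= 1)%N /\ (memory 1 kappa k <= k)%N.
Proof.
by split; rewrite /memory ?geq_minl// (leq_trans (geq_minr _ _))// leq_subr.
Qed.

(** This is what keeps a large earlier residual from spoiling the estimate: a
    bound on the coefficients alone would give a multiple of the larger of the
    two residuals.  As [a 0 *: F_(k-1)] differs from the weighted residual, of
    norm at most [|F_k|], by a multiple [a 1] of [F_k], the earlier residual
    enters only through the product [`|a 0| * |F_(k-1)|], which is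
    [O(|F_k|)]. *)
Lemma weighted_residuals_le u k p a (M : R) : (p <= 1)%N -> (p <= k)%N ->
  enorm (aa_residual G u k p a) <= enorm (residual G (u k)) ->
  \sum_(j < p.+1) `|a j| <= M ->
  \sum_(j < p.+1) `|a j| * enorm (residual G (u (k - p + j)%N)) <=
    (1 + 2 * M) * enorm (residual G (u k)).
Proof.
have F_ge0 := enorm_ge0 (residual G (u k)).
case: p => [|[|//]] _ kp; rewrite /aa_residual !big_ord_recl !big_ord0 /=.
  rewrite subn0 addn0 !addr0 => _; have := normr_ge0 (a 0%N); nra.
rewrite /bump leq0n !addn0 subnK// !addr0 => res aM.
have a0_ge0 := normr_ge0 (a 0%N); have a1_ge0 := normr_ge0 (a 1%N).
have : enorm (a 0%N *: residual G (u (k - 1)%N)) <=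
    (1 + `|a 1%N|) * enorm (residual G (u k)).
  rewrite -[X in enorm X](addrK (a 1%N *: residual G (u k))).
  apply: le_trans (enormB _ _) _.
  by rewrite enormZ mulrDl mul1r lerD.
rewrite enormZ => a0; nra.
Qed.

Lemma bigmax_residuals_le u k p : (p <= 1)%N -> (p <= k)%N ->
  \big[Num.max/0]_(j < p.+1) enorm (residual G (u (k - p + j)%N)) <=
  Num.max (enorm (residual G (u k.-1))) (enorm (residual G (u k))).
Proof.
move=> p1 pk; apply: bigmax_le => [|[j jp] _ /=].
  by rewrite le_max enorm_ge0.
rewrite le_max.
have : (k - p + j)%N = k.-1 \/ (k - p + j)%N = k by lia.
by case=> ->; rewrite lexx ?orbT.
Qed.

Lemma le_bigmax_residuals u k p : (p <= k)%N ->
  enorm (residual G (u k)) <=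
  \big[Num.max/0]_(j < p.+1) enorm (residual G (u (k - p + j)%N)).
Proof.
move=> pk; rewrite -{1}(subnK pk).
exact: (le_bigmax _ (fun j : 'I_p.+1 => enorm (residual G (u (k - p + j)%N)))
  ord_max).
Qed.

(** An accepted Anderson step multiplies the larger of the last two residuals by
    at most [gamma k], and a Krasnosel'skii-Mann step multiplies the last one
    by at most [1 - t], where [t := lambda * (1 - c)].  Both factors are at most
    [1 - t * (1 - gamma k)], so the two kinds of steps fall under one
    recursion, whose rates still have a divergent sum. *)
Lemma globAA_residual_cvg0 (c lambda : R) (gamma : nat -> R) (u0 : 'cV[R]_n) u
    (kappa : nat -> nat) (alpha : nat -> nat -> R) :
  0 <= c -> c < 1 ->
  (forall v w, enorm (G v - G w) <= c * enorm (v - w)) ->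
  0 < lambda -> lambda <= 1 ->
  globAA G 1 lambda gamma u0 u kappa alpha ->
  (forall k, 0 < gamma k < 1) -> nondecreasing_seq gamma ->
  (\sum_(0 <= k <oo) (1 - gamma k)%:E)%E = +oo%E ->
  (fun k => enorm (residual G (u k))) @ \oo --> (0 : R).
Proof.
move=> c_ge0 c_lt1 lip l_gt0 l_le1 run gamma01 gamma_nd dvg.
pose t := lambda * (1 - c).
have t_gt0 : 0 < t by rewrite mulr_gt0// subr_gt0.
have t_le1 : t <= 1 by rewrite /t; nra.
have g0 k : 0 < gamma k by have /andP[] := gamma01 k.
have g1 k : 0 < 1 - gamma k by rewrite subr_gt0; have /andP[] := gamma01 k.
apply: (@cvg0_max_contraction _ _ (fun k => t * (1 - gamma k))).
- by move=> k; exact: enorm_ge0.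
- by move=> k; have := g0 k; have := g1 k; nra.
- by move=> i j ij; rewrite ler_wpM2l ?(ltW t_gt0)// lerB// gamma_nd.
- under eq_eseriesr do rewrite EFinM.
  rewrite nneseriesZl ?dvg ?gt0_muley ?lte_fin// => k _.
  by rewrite lee_fin ltW.
- move=> k; set p := memory 1 kappa k.
  have [p1 pk] : (p <= 1)%N /\ (p <= k)%N := memory1_bounds kappa k.
  have mx_ge0 : 0 <= Num.max (enorm (residual G (u k.-1)))
      (enorm (residual G (u k))).
    by rewrite le_max enorm_ge0.
  rewrite (globAA_u run); case: ifP => [acc|_].
    apply: le_trans acc _; apply: le_trans.
      by apply: ler_wpM2l (bigmax_residuals_le _ _ _ p1 pk); exact: ltW.
    by rewrite ler_wpM2r//; have := g1 k; nra.
  apply: le_trans (enorm_residual_km lip _ _ _) _.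
    by rewrite l_le1 ltW.
  apply: ler_pM; rewrite ?enorm_ge0 ?subr_ge0//.
    by rewrite lerB// ler_piMr ?ltW//; have := g0 k; lra.
  by rewrite le_max lexx orbT.
Qed.

End Run.

Theorem theorem2p11 (R : realType) (n : nat) (G : 'cV[R]_n -> 'cV[R]_n)
    (c : R) (ustar : 'cV[R]_n) (lambda : R) (u0 : 'cV[R]_n)
    (gamma : nat -> R) (u : nat -> 'cV[R]_n) (kappa : nat -> nat)
    (alpha : nat -> nat -> R) (Malpha : R)
    (c_ge0 : 0 <= c) (c_lt1 : c < 1)
    (G_lipschitz : forall v w : 'cV[R]_n, enorm (G v - G w) <= c * enorm (v - w))
    (ustar_fixed : G ustar = ustar)
    (G_differentiable : differentiable G ustar)
    (lambda_gt0 : 0 < lambda) (lambda_le1 : lambda <= 1)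
    (u_globAA : globAA G 1 lambda gamma u0 u kappa alpha)
    (alpha_convention : globAA1_convention G u kappa alpha)
    (never_stops : forall k : nat, residual G (u k) <> 0)
    (gamma_itv : forall k : nat, 0 < gamma k < 1)
    (gamma_nondecreasing : nondecreasing_seq gamma)
    (gamma_cvg : gamma @ \oo --> (1 : R))
    (gamma_series : (\sum_(0 <= k <oo) (1 - gamma k)%:E)%E = +oo%E)
    (alpha_residual : forall k : nat, (1 <= k)%N ->
      enorm (aa_residual G u k (memory 1 kappa k) (alpha k))
        <= enorm (residual G (u k)))
    (alpha_sum : forall k : nat, (1 <= k)%N ->
      \sum_(j < (memory 1 kappa k).+1) alpha k j = 1)
    (Malpha_ge1 : 1 <= Malpha)
    (alpha_bounded : forall k : nat, (1 <= k)%N ->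
      \sum_(j < (memory 1 kappa k).+1) `|alpha k j| <= Malpha) :
  (limn_esup (fun k : nat =>
    (enorm (residual G (u k.+1)) / enorm (residual G (u k)))%:E) <= c%:E)%E.
Proof.
have c1 : 0 < 1 - c by rewrite subr_gt0.
have r0 := globAA_residual_cvg0 _ _ _ _ _ _ _ c_ge0 c_lt1 G_lipschitz lambda_gt0
  lambda_le1 u_globAA gamma_itv gamma_nondecreasing gamma_series.
have r_gt0 k : 0 < enorm (residual G (u k)).
  by rewrite lt_neqAle enorm_ge0 andbT eq_sym enorm_eq0; apply/eqP.
pose K := 1 + 2 * Malpha.
have K_ge1 : 1 <= K by rewrite /K; lra.
apply: limn_esup_le_near => e e_gt0.
(* eps stays below e, for the conclusion, and keeps c + eps < 1, so that
   gamma k eventually exceeds c + eps. *)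
pose eps := Num.min e ((1 - c) / 2).
have eps_gt0 : 0 < eps by rewrite lt_min e_gt0 divr_gt0.
have eps_le : eps <= e by rewrite ge_min lexx.
have ceps_lt1 : c + eps < 1.
  by have : eps <= (1 - c) / 2 by [rewrite ge_min lexx orbT]; lra.
(* The relative error of the expansion of G, chosen so that the error term
   2 * _ / (1 - c) * (K * |F_k|) of the mixture estimate is eps * |F_k|. *)
have eta_gt0 : 0 < eps * (1 - c) / (2 * K).
  by rewrite !(divr_gt0, mulr_gt0)//; lra.
have [delta delta_gt0] :=
  differentiable_enorm _ _ _ _ _ G_differentiable eta_gt0.
rewrite ustar_fixed => linG.
have [N _ smallN] : \forall k \near \oo,
    K * enorm (residual G (u k)) <= (1 - c) * delta.
  have := r0 => /cvgrPdist_le /(_ ((1 - c) * delta / K)).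
  have -> : 0 < (1 - c) * delta / K by rewrite divr_gt0 ?mulr_gt0//; lra.
  move=> /(_ isT); apply: filterS => k.
  rewrite sub0r normrN ger0_norm ?enorm_ge0// ler_pdivlMr; last by lra.
  by rewrite mulrC.
have [N' _ gammaN] : \forall k \near \oo, c + eps <= gamma k.
  have := gamma_cvg => /cvgrPdist_le /(_ (1 - (c + eps))).
  rewrite subr_gt0 ceps_lt1.
  by move=> /(_ isT); apply: filterS => k; rewrite ler_distlC; lra.
(* One more than N, as u_(k-1) must also be close to ustar. *)
exists (maxn N N').+1 => // k /= kN.
have kge1 : (1 <= k)%N by exact: leq_trans kN.
have [p1 pk] := memory1_bounds kappa k.
have Nk1 : (N <= k.-1)%N.
  by rewrite -ltnS prednK// (leq_trans _ kN)// ltnS leq_maxl.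
have N'k : (N' <= k)%N by rewrite (leq_trans _ (ltnW kN))// leq_maxr.
have weights := weighted_residuals_le _ _ _ _ _ p1 pk (alpha_residual k kge1)
  (alpha_bounded k kge1).
have cand : enorm (residual G (aa_candidate G u k (memory 1 kappa k) (alpha k)))
    <= (c + eps) * enorm (residual G (u k)).
  apply: le_trans.
    apply: (enorm_residual_mixture G_lipschitz _ _ _ _ _
      (fun j : 'I__ => alpha k j)
      (fun j : 'I__ => u (k - memory 1 kappa k + j)%N)
      c_ge0 c_lt1 (ltW eta_gt0) ustar_fixed linG).
    - exact: alpha_sum.
    - move=> j.
      have kj : (N <= k - memory 1 kappa k + j)%N.
        rewrite (leq_trans Nk1)// -subn1 (leq_trans (leq_sub2l k p1))//.
        exact: leq_addr.
      by apply: le_trans (smallN _ kj); rewrite ler_peMl ?enorm_ge0.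
    - apply: le_trans weights _; apply: smallN.
      by rewrite /= (leq_trans Nk1)// leq_pred.
  rewrite [leRHS]mulrDl lerD//.
    by rewrite ler_wpM2l//; exact: alpha_residual.
  apply: le_trans.
    apply: ler_wpM2l weights.
    by rewrite divr_ge0 ?ltW// mulr_gt0.
  rewrite -/K mulrA ler_wpM2r ?enorm_ge0// le_eqVlt; apply/orP; left; apply/eqP.
  by field; rewrite !gt_eqF//; lra.
have accepted : aa_accepted G (gamma k) u k (memory 1 kappa k) (alpha k).
  apply: le_trans cand _; apply: ler_pM; rewrite ?enorm_ge0//.
  - by rewrite addr_ge0// ltW.
  - exact: gammaN.
  - exact: le_bigmax_residuals.
rewrite (globAA_u u_globAA) accepted ler_pdivrMr//.
by apply: le_trans cand _; rewrite ler_wpM2r ?enorm_ge0// lerD2l.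
Qed.
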